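(* Let $A=\sigma(R)\langle x_1,\dots,x_n\rangle$ be a $\sigma$-PBW extension such that $c_{\alpha,\beta}$ is invertible for all $\alpha,\beta\in\mathbb N^n$. Let $\mathbf f,\mathbf h\in A^m$, let $\theta\in\mathbb N^n$, and let $F=\{\mathbf f_1,\dots,\mathbf f_t\}$ be a finite set of nonzero vectors of $A^m$. Then: (i) If $\mathbf f\xrightarrow{F}\mathbf h$, then there exists $\mathbf p\in A^m$ with $\mathbf p=\mathbf 0$ or $lm(x^\theta\mathbf f)\succ lm(\mathbf p)$ such that $x^\theta\mathbf f+\mathbf p\xrightarrow{F}x^\theta\mathbf h$. If $A$ is quasi-commutative, one can take $\mathbf p=\mathbf 0$. (ii) If $\mathbf f\xrightarrow{F}_+\mathbf h$ and $\mathbf p\in A^m$ satisfies $\mathbf p=\mathbf 0$ or $lm(\mathbf h)\succ lm(\mathbf p)$, then $\mathbf f+\mathbf p\xrightarrow{F}_+\mathbf h+\mathbf p$. (iii) If $\mathbf f\xrightarrow{F}_+\mathbf h$, then there exists $\mathbf p\in A^m$ with $\mathbf p=\mathbf 0$ or $lm(x^\theta\mathbf f)\succ lm(\mathbf p)$ such that $x^\theta\mathbf f+\mathbf p\xrightarrow{F}_+x^\theta\mathbf h$. If $A$ is quasi-commutative, one can take $\mathbf p=\mathbf 0$. (iv) If $\mathbf f\xrightarrow{F}_+\mathbf 0$, then there exists $\mathbf p\in A^m$ with $\mathbf p=\mathbf 0$ or $lm(x^\theta\mathbf f)\succ lm(\mathbf p)$ such that $x^\theta\mathbf f+\mathbf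 p\xrightarrow{F}_+\mathbf 0$. If $A$ is quasi-commutative, one can take $\mathbf p=\mathbf 0$.
   Context: Let $R\subseteq A$ be rings. $A$ is a $\sigma$-PBW extension of $R$, written $A=\sigma(R)\langle x_1,\dots,x_n\rangle$, if there are $x_1,\dots,x_n\in A\setminus R$ such that: (i) $A$ is a free left $R$-module with basis $\mathrm{Mon}(A)=\{x^\alpha=x_1^{\alpha_1}\cdots x_n^{\alpha_n}:\alpha\in\mathbb N^n\}$, with $x^0=1$; (ii) for every $i$ and every $r\in R\setminus\{0\}$ there is $c_{i,r}\in R\setminus\{0\}$ with $x_ir-c_{i,r}x_i\in R$; (iii) for all $i,j$ there is $c_{i,j}\in R\setminus\{0\}$ with $x_jx_i-c_{i,j}x_ix_j\in R+Rx_1+\dots+Rx_n$. There are injective ring endomorphisms $\sigma_i$ of $R$ and $\sigma_i$-derivations $\delta_i$ with $x_ir=\sigma_i(r)x_i+\delta_i(r)$. Write $\sigma^\alpha=\sigma_1^{\alpha_1}\circ\cdots\circ\sigma_n^{\alpha_n}$ and $|\alpha|=\sum\alpha_i$. The degree of a nonzero element of $A$ is the maximum of $|\alpha|$ over the monomials $x^\alpha$ occurring in it. For $\alpha,\beta\in\mathbb N^n$ there are unique $c_{\alpha,\beta}\in R$ (left invertible) and $p_{\alpha,\beta}\in A$ with $x^\alpha x^\beta=c_{\alpha,\beta}x^{\alpha+\beta}+p_{\alpha,\beta}$, where $p_{\alpha,\beta}=0$ or $\deg p_{\alpha,\beta}<|\alpha+\beta|$. $A$ is quasi-commutative if $x_ir=c_{i,r}x_i$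 and $x_jx_i=c_{i,j}x_ix_j$ exactly. Standing assumptions: $R$ is left Gröbner soluble (left Noetherian; membership of $a$ in a left ideal $Rr_1+\dots+Rr_m$ is decidable, with coefficients computable; and finite generating sets of $\mathrm{Syz}_R[r_1\cdots r_m]=\{(b_1,\dots,b_m)\in R^m:\sum b_ir_i=0\}$ are computable). $\mathrm{Mon}(A)$ carries a monomial order, i.e. a total order $\succeq$ with: (a) $x^\beta\succeq x^\alpha\Rightarrow lm(x^\gamma x^\beta x^\lambda)\succeq lm(x^\gamma x^\alpha x^\lambda)$; (b) $x^\alpha\succeq1$; (c) $|\beta|\ge|\alpha|\Rightarrow x^\beta\succeq x^\alpha$. $A^m$ is the free left $A$-module of column vectors with canonical basis $\mathbf e_i$. A monomial of $A^m$ is $x^\alpha\mathbf e_i$, with $\mathrm{ind}=i$, $\exp=\alpha$, $\deg=|\alpha|$. The monomial $x^\alpha\mathbf e_i$ divides $x^\beta\mathbf e_j$ iff $i=j$ and $\beta_k\ge\alpha_k$ for all $k$. $\mathrm{Mon}(A^m)$ carries a monomial order, i.e. a total order with: (i) $lm(x^\beta x^\alpha)\mathbf e_i\succeq x^\alpha\mathbf e_i$; (ii) $x^\beta\mathbf e_j\succeq x^\alpha\mathbf e_i\Rightarrow lm(x^\gamma x^\beta)\mathbf e_j\succeq lm(x^\gamma x^\alpha)\mathbf e_i$; (iii) $\deg\mathbf X\ge\deg\mathbf Y\Rightarrow\mathbf X\succeq\mathbf Y$. Writing a nonzero $\mathbf f=c_1\mathbf X_1+\dots+c_t\mathbf X_t$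 with $c_i\in R\setminus\{0\}$ and $\mathbf X_1\succ\dots\succ\mathbf X_t$, set $lm(\mathbf f)=\mathbf X_1$, $lc(\mathbf f)=c_1$, $lt(\mathbf f)=c_1\mathbf X_1$. Also $lm(\mathbf 0)=\mathbf 0$, and $\mathbf X\succ\mathbf 0$ for every monomial $\mathbf X$. Reduction. Let $F$ be a finite set of nonzero vectors of $A^m$ and $\mathbf f,\mathbf h\in A^m$. We say $\mathbf f$ reduces to $\mathbf h$ by $F$ in one step, $\mathbf f\xrightarrow{F}\mathbf h$, if there are $\mathbf f_1,\dots,\mathbf f_t\in F$ and $r_1,\dots,r_t\in R$ with: (1) $lm(\mathbf f_i)\mid lm(\mathbf f)$, i.e. $\mathrm{ind}(lm\,\mathbf f_i)=\mathrm{ind}(lm\,\mathbf f)$ and $\alpha_i+\exp(lm\,\mathbf f_i)=\exp(lm\,\mathbf f)$ for some $\alpha_i\in\mathbb N^n$; (2) $lc(\mathbf f)=\sum_i r_i\sigma^{\alpha_i}(lc(\mathbf f_i))c_{\alpha_i,\exp(lm(\mathbf f_i))}$; (3) $\mathbf h=\mathbf f-\sum_i r_ix^{\alpha_i}\mathbf f_i$. By convention $\mathbf 0\xrightarrow{F}\mathbf 0$. We write $\mathbf f\xrightarrow{F}_+\mathbf h$ if there is a finite chain $\mathbf f\xrightarrow{F}\mathbf h_1\xrightarrow{F}\cdots\xrightarrow{F}\mathbf h$ of one-step reductions. *)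

(* Defs.v *)
From HB Require Import structures.
From mathcomp Require Import all_boot all_order all_algebra.
Set Implicit Arguments. Unset Strict Implicit. Unset Printing Implicit Defensive.
Import GRing.Theory.
Local Open Scope ring_scope.

Definition exps (n : nat) := {ffun 'I_n -> nat}.
Definition exp0 (n : nat) : exps n := [ffun _ => 0%N].
Definition eunit (n : nat) (i : 'I_n) : exps n := [ffun k => nat_of_bool (k == i)].
Definition addE (n : nat) (a b : exps n) : exps n := [ffun k => (a k + b k)%N].
Definition deg (n : nat) (a : exps n) : nat := (\sum_(k < n) a k)%N.

Section PBW.
Variables (R A : nzRingType) (iota : R -> A) (n : nat) (x : 'I_n -> A)
          (coef : A -> exps n -> R) (supp : A -> seq (exps n)).

Definition xmon (a : exps n) : A := \prod_(k < n) x k ^+ a k.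

(* A is a free left R-module with basis Mon(A); [coef a alpha] is the
   coordinate of a on x^alpha and [supp a] lists its (finite) support. *)
Definition free_basis : Prop :=
  [/\ forall a al, (al \in supp a) = (coef a al != 0),
      forall a, uniq (supp a),
      forall a, a = \sum_(al <- supp a) iota (coef a al) * xmon al
    & forall (s : seq (exps n)) (c : exps n -> R), uniq s ->
        \sum_(al <- s) iota (c al) * xmon al = 0 ->
        forall al, al \in s -> c al = 0].

Definition sigma_PBW : Prop :=
  [/\ injective iota,
      free_basis,
      forall i r, x i != iota r,
      (forall i (r : R), r != 0 -> exists2 c : R, c != 0 &
          exists r' : R, x i * iota r - iota c * x i = iota r')
    & (forall i j, exists2 c : R, c != 0 &
          exists (r0 : R) (r : 'I_n -> R),
            x j * x i - iota c * x i * x j = iota r0 + \sum_(k < n) iota (r k) * x k)].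

Definition quasi_commutative : Prop :=
  (forall i (r : R), r != 0 -> exists2 c : R, c != 0 & x i * iota r = iota c * x i)
  /\ (forall i j, exists2 c : R, c != 0 & x j * x i = iota c * x i * x j).

(* sigma_i(r): the coefficient of x_i in x_i r = sigma_i(r) x_i + delta_i(r) *)
Definition sigmai (i : 'I_n) (r : R) : R := coef (x i * iota r) (eunit i).
Definition sigmaE (a : exps n) (r : R) : R :=
  foldr (fun i acc => iter (a i) (sigmai i) acc) r (enum 'I_n).
(* c_{alpha,beta}: x^alpha x^beta = c_{alpha,beta} x^{alpha+beta} + p_{alpha,beta} *)
Definition cab (a b : exps n) : R := coef (xmon a * xmon b) (addE a b).

Definition two_sided_unit (c : R) : Prop := exists u : R, u * c = 1 /\ c * u = 1.

Definition left_ideal (I : R -> Prop) : Prop :=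
  [/\ I 0, (forall a b, I a -> I b -> I (a + b)) & (forall r a, I a -> I (r * a))].
Definition left_noetherian : Prop :=
  forall I : nat -> R -> Prop, (forall k, left_ideal (I k)) ->
    (forall k a, I k a -> I k.+1 a) ->
    exists N, forall k, (N <= k)%N -> forall a, I k a <-> I N a.

(* Total orders, leading monomials (lm(0) = 0 encoded as None)             *)
Definition total_order (T : eqType) (le : rel T) : Prop :=
  [/\ reflexive le, antisymmetric le, transitive le & total le].

Definition omax (T : Type) (le : rel T) (s : seq T) : option T :=
  foldr (fun X acc => match acc with
                      | None => Some X
                      | Some Y => if le X Y then Some X else Some Y end) None s.

(* X >= Y on monomials extended by 0 (None), with X > 0 for all monomials *)
Definition geO (T : Type) (le : rel T) (o1 o2 : option T) : bool :=
  match o1, o2 with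
  | Some X, Some Y => le X Y
  | _, None => true
  | None, Some _ => false
  end.
Definition gtO (T : eqType) (le : rel T) (o1 o2 : option T) : bool :=
  match o1, o2 with
  | Some X, Some Y => le X Y && (X != Y)
  | Some _, None => true
  | None, _ => false
  end.

Definition lmA (ordA : rel (exps n)) (a : A) : option (exps n) := omax ordA (supp a).

(* monomial order on Mon(A) (condition (c) read strictly) *)
Definition monomial_order_A (ordA : rel (exps n)) : Prop :=
  [/\ total_order ordA,
      (forall a b g l, ordA b a ->
         geO ordA (lmA ordA (xmon g * xmon b * xmon l)) (lmA ordA (xmon g * xmon a * xmon l))),
      (forall a, ordA a (exp0 n))
    & (forall a b, (deg a < deg b)%N -> ordA b a && (b != a))].

(* The free module A^m (column vectors); monomials x^alpha e_i = (alpha,i) *)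
Variable m : nat.
Notation vec := 'cV[A]_m.
Notation monm := (exps n * 'I_m)%type.

Definition vsupp (f : vec) : seq monm :=
  [seq (al, i) | i <- enum 'I_m, al <- supp (f i 0)].
Definition vcoef (f : vec) (X : monm) : R := coef (f X.2 0) X.1.

Definition liftm (i : 'I_m) (o : option (exps n)) : option monm := omap (fun a => (a, i)) o.

(* monomial order on Mon(A^m) (condition (iii) read strictly) *)
Definition monomial_order_Am (ordA : rel (exps n)) (ordM : rel monm) : Prop :=
  [/\ total_order ordM,
      (forall b a i, geO ordM (liftm i (lmA ordA (xmon b * xmon a))) (Some (a, i))),
      (forall b j a i g, ordM (b, j) (a, i) ->
         geO ordM (liftm j (lmA ordA (xmon g * xmon b))) (liftm i (lmA ordA (xmon g * xmon a))))
    & (forall X Y : monm, (deg Y.1 < deg X.1)%N -> ordM X Y && (X != Y))].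

Section Reduction.
Variable ordM : rel monm.

Definition lm (f : vec) : option monm := omax ordM (vsupp f).
Definition lc (f : vec) : R := if lm f is Some X then vcoef f X else 0.

(* One-step reduction f --F--> h.  A reduction datum is a list of triples
   (f_i, alpha_i, r_i) with f_i in F. *)
Definition red1 (F : seq vec) (f h : vec) : Prop :=
  (f = 0 /\ h = 0) \/
  exists s : seq (vec * exps n * R),
    [/\ forall e, e \in s ->
          e.1.1 \in F /\
          exists (b : exps n) (i : 'I_m),
            lm e.1.1 = Some (b, i) /\ lm f = Some (addE e.1.2 b, i),
        lc f = \sum_(e <- s)
                 e.2 * sigmaE e.1.2 (lc e.1.1) *
                 (if lm e.1.1 is Some Y then cab e.1.2 Y.1 else 0)
      & h = f - \sum_(e <- s) (iota e.2 * xmon e.1.2) *: e.1.1].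

Inductive redplus (F : seq vec) : vec -> vec -> Prop :=
| redplus_one f h : red1 F f h -> redplus F f h
| redplus_step f g h : red1 F f g -> redplus F g h -> redplus F f h.

End Reduction.
End PBW.

(* Main.v *)
(* In A every product x^th r x^al equals sigma^th(r) c_{th,al} x^{th+al} plus terms of
   smaller total degree, and these terms vanish when A is quasi-commutative.  Since
   sigma^th keeps nonzero elements nonzero, c_{th,al} is invertible and the monomial
   orders refine total degree, lm(x^th f) = x^th lm(f).  Multiplying a one-step
   reduction h = f - sum r_i x^(al_i) f_i by x^th thus gives
   x^th h = x^th f + p - sum sigma^th(r_i) c_{th,al_i} x^(th+al_i) f_i, where p
   collects the lower-degree terms and lies strictly below lm(x^th f); the new
   leading coefficient condition is read off the coefficient of lm(x^th f) in x^th h,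
   which is zero.  Adding to the start of a chain a vector strictly below its end
   changes neither the leading monomial nor the leading coefficient of any step,
   which gives (ii) and, combined with (i) along the chain, (iii) and (iv). *)

Require Import Defs.
From HB Require Import structures.
From mathcomp Require Import all_boot all_order all_algebra.
Set Implicit Arguments. Unset Strict Implicit. Unset Printing Implicit Defensive.
Import GRing.Theory.
Local Open Scope ring_scope.

Section Exponents.
Variable n : nat.
Implicit Types a b c : exps n.

Lemma addEC a b : addE a b = addE b a.
Proof. by apply/ffunP => k; rewrite !ffunE addnC. Qed.

Lemma addEA a b c : addE a (addE b c) = addE (addE a b) c.
Proof. by apply/ffunP => k; rewrite !ffunE addnA. Qed.

Lemma add0E a : addE (exp0 n) a = a.
Proof. by apply/ffunP => k; rewrite !ffunE. Qed.

Lemma addEI a : injective (addE a).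
Proof.
by move=> b c /ffunP eq_bc; apply/ffunP => k; have := eq_bc k; rewrite !ffunE => /addnI.
Qed.

Lemma degD a b : deg (addE a b) = (deg a + deg b)%N.
Proof. by rewrite /deg -big_split; apply: eq_bigr => k _; rewrite ffunE. Qed.

Lemma deg_exp0 : deg (exp0 n) = 0%N.
Proof. by rewrite /deg big1 // => k _; rewrite ffunE. Qed.

Lemma deg_eunit (i : 'I_n) : deg (eunit i) = 1%N.
Proof.
rewrite /deg (bigD1 i) //= ffunE eqxx big1 // => k /negbTE.
by rewrite ffunE => ->.
Qed.

Lemma deg_addE_eunit a (i : 'I_n) : deg (addE a (eunit i)) = (deg a).+1.
Proof. by rewrite degD deg_eunit addn1. Qed.

Lemma deg_eq0 a : deg a = 0%N -> a = exp0 n.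
Proof.
move=> /eqP; rewrite /deg sum_nat_eq0 => /forallP a0; apply/ffunP => k.
by have /eqP := a0 k; rewrite ffunE.
Qed.

Lemma eunit_neq0 (i : 'I_n) : eunit i != exp0 n.
Proof. by apply/eqP => e; have := deg_eunit i; rewrite e deg_exp0. Qed.

(* x^a is the ordered product x_1^a_1 ... x_n^a_n, so x_j splits off on the left of
   x^(a + e_j) when a vanishes below j; see [xmon_cons]. *)
Definition zero_below (j : 'I_n) a := forall k : 'I_n, (k < j)%N -> a k = 0%N.

Lemma exps_split_least a : (0 < deg a)%N ->
  exists j a', [/\ a = addE a' (eunit j), zero_below j a' & deg a = (deg a').+1].
Proof.
move=> deg_gt0.
have [i0 ai0] : exists i, (0 < a i)%N.
  apply/existsP; move: deg_gt0; apply: contraLR; rewrite negb_exists => /forallP a0.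
  rewrite -leqNgt leqn0 /deg sum_nat_eq0; apply/forallP => k.
  by have := a0 k; rewrite -leqNgt leqn0.
have [j aj j_min] := @arg_minnP _ i0 (fun k => 0 < a k)%N (fun k : 'I_n => val k) ai0.
pose a' := [ffun k => (a k - (k == j))%N].
have Ea : a = addE a' (eunit j).
  apply/ffunP => k; rewrite !ffunE; case: eqP => [->|_]; last by rewrite !subn0 addn0.
  by rewrite subnK.
exists j, a'; split=> //; last by rewrite {1}Ea deg_addE_eunit.
move=> k kj; rewrite ffunE; case: eqP => [ekj|_]; first by move: kj; rewrite ekj ltnn.
rewrite subn0; apply/eqP; rewrite -leqn0 leqNgt; apply/negP => /j_min.
by rewrite leqNgt kj.
Qed.

Lemma deg_lt2 a : (deg a < 2)%N -> a = exp0 n \/ exists k, a = eunit k.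
Proof.
move=> lt2; have [/deg_eq0 ->|pos] := posnP (deg a); first by left.
have [k [a' [Ea _ da]]] := exps_split_least pos; right; exists k.
by rewrite Ea (deg_eq0 (a := a')) ?add0E //; move: lt2; rewrite da !ltnS leqn0 => /eqP.
Qed.

Lemma exps_ind (P : exps n -> Prop) : P (exp0 n) ->
  (forall a j, zero_below j a -> P a -> P (addE a (eunit j))) -> forall a, P a.
Proof.
move=> P0 PS a; move: {2}(deg a) (erefl (deg a)) => d.
elim: d a => [|d IH] a deg_a; first by rewrite (deg_eq0 deg_a).
have [|j [a' [Ea za' deg_a']]] := exps_split_least (a := a); first by rewrite deg_a.
by rewrite Ea; apply: PS => //; apply: IH; move: deg_a; rewrite deg_a' => -[].
Qed.

Lemma enum_ord_split (j : 'I_n) : exists l1 l2, [/\ enum 'I_n = l1 ++ j :: l2,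
  forall k, k \in l1 -> (k < j)%N & forall k, k \in l2 -> (j < k)%N].
Proof.
set e := enum 'I_n; have size_e : size e = n by rewrite size_enum_ord.
exists (take j e), (drop j.+1 e); split.
- by rewrite -{1}(cat_take_drop j e) (drop_nth j) ?size_e // nth_ord_enum.
- move=> k /(map_f val); rewrite map_take val_enum_ord take_iota mem_iota leq_min.
  by case/andP=> _ /andP[].
- move=> k /(map_f val); rewrite map_drop val_enum_ord drop_iota mem_iota add0n.
  by case/andP.
Qed.

Definition iter_exps (T : Type) (sg : 'I_n -> T -> T) a (r : T) : T :=
  foldr (fun i acc => iter (a i) (sg i) acc) r (enum 'I_n).

Variables (T : Type) (sg : 'I_n -> T -> T).

Lemma iter_exps0 r : iter_exps sg (exp0 n) r = r.
Proof. by rewrite /iter_exps; elim: (enum 'I_n) => //= i s ->; rewrite ffunE. Qed.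

Lemma iter_exps_cons a j r : zero_below j a ->
  iter_exps sg (addE a (eunit j)) r = sg j (iter_exps sg a r).
Proof.
move=> za; rewrite /iter_exps; have [l1 [l2 [-> lt_l1 gt_l2]]] := enum_ord_split j.
have iter_l1 b z : (forall k, k \in l1 -> b k = 0%N) ->
    foldr (fun i acc => iter (b i) (sg i) acc) z l1 = z.
  elim: l1 {lt_l1} => //= k l IH b0; rewrite b0 ?mem_head //= IH // => k' k'l.
  by apply: b0; rewrite inE k'l orbT.
have za' k : k \in l1 -> addE a (eunit j) k = 0%N.
  move=> /lt_l1 kj; rewrite !ffunE za //.
  by case: eqP => [ekj|]; [move: kj; rewrite ekj ltnn|].
rewrite !foldr_cat /= !iter_l1 //; last by move=> k /lt_l1; apply: za.
rewrite !ffunE eqxx addn1 iterS; congr (sg j (iter _ _ _)).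
elim: l2 gt_l2 => //= k l2 IH gt_l2; rewrite IH => [|k' kl]; last first.
  by apply: gt_l2; rewrite inE kl orbT.
rewrite !ffunE; case: eqP => [ekj|]; last by rewrite addn0.
by have := gt_l2 k (mem_head _ _); rewrite ekj ltnn.
Qed.

End Exponents.

Lemma xmon_cons (A : nzRingType) (n : nat) (x : 'I_n -> A) (a : exps n) (j : 'I_n) :
  zero_below j a -> xmon x (addE a (eunit j)) = x j * xmon x a.
Proof.
move=> za; rewrite /xmon [index_enum _]unlock -enumT.
have [l1 [l2 [-> lt_l1 gt_l2]]] := enum_ord_split j.
rewrite !big_cat !big_cons /=.
have prod_l1 (F : 'I_n -> A) : (forall k, k \in l1 -> F k = 1) -> \prod_(k <- l1) F k = 1.
  by move=> F1; rewrite big_seq big1.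
rewrite [X in X * _ = _]prod_l1 => [|k /[dup] /lt_l1 kj kl]; last first.
  rewrite !ffunE za //; case: eqP => [ekj|]; last by rewrite addn0 expr0.
  by move: kj; rewrite ekj ltnn.
rewrite [X in _ = _ * (X * _)]prod_l1 => [|k /lt_l1 /za ->]; last by rewrite expr0.
rewrite !mul1r !ffunE eqxx addn1 exprS -mulrA; congr (_ * (_ * _)).
apply: eq_big_seq => k /gt_l2 jk; rewrite !ffunE.
by case: eqP => [ekj|]; [move: jk; rewrite ekj ltnn|rewrite addn0].
Qed.

Lemma xmon0 (A : nzRingType) (n : nat) (x : 'I_n -> A) : xmon x (exp0 n) = 1.
Proof. by rewrite /xmon big1 // => k _; rewrite ffunE expr0. Qed.

Lemma xmon_eunit (A : nzRingType) (n : nat) (x : 'I_n -> A) (i : 'I_n) :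
  xmon x (eunit i) = x i.
Proof. by rewrite -[eunit i]add0E xmon_cons ?xmon0 ?mulr1 // => k _; rewrite ffunE. Qed.

Section TotalOrder.
Variables (T : eqType) (le : rel T).
Hypothesis le_total : total_order le.

Definition strict (X Y : T) := le X Y && (X != Y).

Lemma strict_irr X : strict X X = false.
Proof. by rewrite /strict eqxx andbF. Qed.

Lemma strictW X Y : strict X Y -> le X Y.
Proof. by case/andP. Qed.

Lemma strict_le_trans Y X Z : strict X Y -> le Y Z -> strict X Z.
Proof.
case: le_total => _ asym tr _ /andP[XY nXY] YZ; rewrite /strict (tr _ _ _ XY YZ).
by apply: contraNneq nXY => eXZ; apply/eqP/asym; rewrite XY eXZ.
Qed.

Lemma le_strict_trans Y X Z : le X Y -> strict Y Z -> strict X Z.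
Proof.
case: le_total => _ asym tr _ XY /andP[YZ nYZ]; rewrite /strict (tr _ _ _ XY YZ).
by apply: contraNneq nYZ => eXZ; apply/eqP/asym; rewrite YZ -eXZ.
Qed.

Lemma strict_leF X Y : strict X Y -> le Y X = false.
Proof.
case: le_total => _ asym _ _ /andP[XY nXY]; apply: contraNF nXY => YX.
by apply/eqP/asym; rewrite XY YX.
Qed.

Lemma omax_some s X : omax le s = Some X -> X \in s /\ forall Y, Y \in s -> le X Y.
Proof.
case: le_total => refl _ tr tot; elim: s X => [//|a s IH] X /=.
case Es: (omax le s) => [Y|] => [|[<-]]; last first.
  split=> [|Z]; first exact: mem_head.
  have -> : s = [::] by case: s {IH} Es => //= b s; case: (omax le s) => [?|]; [case: ifP|].
  by rewrite inE => /eqP ->.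
have [Ys Ymax] := IH _ Es; case: ifP => aY [<-].
  split=> [|Z]; first exact: mem_head.
  by rewrite inE => /orP[/eqP->|/Ymax]; [apply: refl|apply: tr].
split=> [|Z]; first by rewrite inE Ys orbT.
by rewrite inE => /orP[/eqP->|/Ymax//]; have := tot a Y; rewrite aY.
Qed.

Lemma omax_none s : omax le s = None -> s = [::].
Proof. by case: s => //= a s; case: (omax le s) => [?|]; [case: ifP|]. Qed.

Lemma omax_eq s X : X \in s -> (forall Y, Y \in s -> le X Y) -> omax le s = Some X.
Proof.
move=> Xs Xmax; case Es: (omax le s) => [Z|]; last by move: Xs; rewrite (omax_none Es).
have [Zs Zmax] := omax_some Es; case: le_total => _ asym _ _.
by congr Some; apply: asym; rewrite Zmax // Xmax.
Qed.

End TotalOrder.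

Lemma sum_mem_subseq (V : nmodType) (T : eqType) (s t : seq T) (F : T -> V) :
  uniq s -> uniq t -> {subset s <= t} ->
  \sum_(a <- t) (if a \in s then F a else 0) = \sum_(a <- s) F a.
Proof.
move=> us ut st; rewrite -big_mkcond -big_filter; apply: perm_big.
apply: uniq_perm; [exact: filter_uniq | exact: us | move=> a].
by rewrite mem_filter; apply/andP/idP => [[]//|sa]; split=> //; apply: st.
Qed.

Lemma sum_neq0 (V : nmodType) (T : eqType) (s : seq T) (F : T -> V) :
  \sum_(a <- s) F a != 0 -> exists2 a, a \in s & F a != 0.
Proof.
elim: s => [|a s IH]; first by rewrite big_nil eqxx.
rewrite big_cons; have [Fa0|] := eqVneq (F a) 0; last by exists a; rewrite ?mem_head.
by rewrite Fa0 add0r => /IH [b bs Fb]; exists b; rewrite // inE bs orbT.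
Qed.

Section PBWExtension.
Variables (R A : nzRingType) (iota : {rmorphism R -> A}) (n : nat) (x : 'I_n -> A)
  (coef : A -> exps n -> R) (supp : A -> seq (exps n)).
Hypothesis HPBW : sigma_PBW iota x coef supp.

Local Notation xm := (xmon x).
Implicit Types (a b : A) (al be th : exps n).

Lemma mem_supp a al : (al \in supp a) = (coef a al != 0).
Proof. by case: HPBW => _ []. Qed.

Lemma supp_uniq a : uniq (supp a).
Proof. by case: HPBW => _ []. Qed.

Lemma coef_expand a : a = \sum_(al <- supp a) iota (coef a al) * xm al.
Proof. by case: HPBW => _ []. Qed.

Lemma xmon_free (s : seq (exps n)) (c : exps n -> R) : uniq s ->
  \sum_(al <- s) iota (c al) * xm al = 0 -> forall al, al \in s -> c al = 0.
Proof. by case: HPBW => _ [_ _ _ free] _ _ _; apply: free. Qed.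

Lemma coef_expand_on a t : uniq t -> {subset supp a <= t} ->
  a = \sum_(al <- t) iota (coef a al) * xm al.
Proof.
move=> ut st; rewrite {1}(coef_expand a) -(sum_mem_subseq _ (supp_uniq a) ut st).
apply: eq_bigr => al _; case: ifP => // /negbT; rewrite mem_supp negbK => /eqP ->.
by rewrite rmorph0 mul0r.
Qed.

Lemma coef_comb (s : seq (exps n)) (c : exps n -> R) be : uniq s ->
  coef (\sum_(al <- s) iota (c al) * xm al) be = if be \in s then c be else 0.
Proof.
set a := \sum_(al <- s) _ => us.
pose t := undup (s ++ supp a); have ut : uniq t := undup_uniq _.
have st : {subset s <= t} by move=> y ys; rewrite mem_undup mem_cat ys.
have at_ : {subset supp a <= t} by move=> y ys; rewrite mem_undup mem_cat ys orbT.
pose d al := (if al \in s then c al else 0) - coef a al.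
have d_free : \sum_(al <- t) iota (d al) * xm al = 0.
  under eq_bigr => al _ do rewrite rmorphB mulrBl.
  rewrite sumrB -(coef_expand_on ut at_); apply/eqP; rewrite subr_eq0; apply/eqP.
  rewrite /a -(sum_mem_subseq _ us ut st).
  by apply: eq_bigr => al _; case: ifP => //; rewrite rmorph0 mul0r.
case bt : (be \in t).
  by have /eqP := xmon_free ut d_free bt; rewrite subr_eq0 => /eqP <-.
have /negbTE -> : be \notin s by apply: contraFN bt; apply: st.
have : be \notin supp a by apply: contraFN bt; apply: at_.
by rewrite mem_supp negbK => /eqP.
Qed.

Lemma coef_mon r al be : coef (iota r * xm al) be = if al == be then r else 0.
Proof.
by rewrite -[_ * _](big_seq1 +%R al (fun al => iota r * xm al)) coef_comb // inE eq_sym.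
Qed.

Lemma coefD a b be : coef (a + b) be = coef a be + coef b be.
Proof.
pose t := undup (supp a ++ supp b); have ut : uniq t := undup_uniq _.
have sa : {subset supp a <= t} by move=> y ys; rewrite mem_undup mem_cat ys.
have sb : {subset supp b <= t} by move=> y ys; rewrite mem_undup mem_cat ys orbT.
rewrite {1}(coef_expand_on ut sa) {1}(coef_expand_on ut sb) -big_split /=.
under eq_bigr => al _ do rewrite -mulrDl -rmorphD.
rewrite coef_comb //; case: ifP => // /negbT bt.
have /negbTE : be \notin supp a by apply: contra bt; apply: sa.
have /negbTE : be \notin supp b by apply: contra bt; apply: sb.
by rewrite !mem_supp => /negbFE/eqP -> /negbFE/eqP ->; rewrite addr0.
Qed.

Lemma coef_iotaM r a be : coef (iota r * a) be = r * coef a be.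
Proof.
rewrite {1}(coef_expand a) mulr_sumr.
under eq_bigr => al _ do rewrite mulrA -rmorphM.
rewrite coef_comb ?supp_uniq //; case: ifP => // /negbT.
by rewrite mem_supp negbK => /eqP ->; rewrite mulr0.
Qed.

Lemma coef0 be : coef 0 be = 0.
Proof. by rewrite -(mul0r 1) -(rmorph0 iota) coef_iotaM mul0r. Qed.

Lemma coefN a be : coef (- a) be = - coef a be.
Proof. by rewrite -mulN1r -(rmorphN1 iota) coef_iotaM mulN1r. Qed.

Lemma coefB a b be : coef (a - b) be = coef a be - coef b be.
Proof. by rewrite coefD coefN. Qed.

Lemma coef_sum (I : Type) (s : seq I) (F : I -> A) be :
  coef (\sum_(i <- s) F i) be = \sum_(i <- s) coef (F i) be.
Proof.
elim: s => [|i s IH]; first by rewrite !big_nil coef0.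
by rewrite !big_cons coefD IH.
Qed.

Lemma coef_eq0 a : (forall al, coef a al = 0) -> a = 0.
Proof. by move=> a0; rewrite (coef_expand a) big1 // => al _; rewrite a0 rmorph0 mul0r. Qed.

Definition deg_lt k a := forall al, coef a al != 0 -> (deg al < k)%N.

Lemma deg_lt0 k : deg_lt k 0.
Proof. by move=> al; rewrite coef0 eqxx. Qed.

Lemma deg_ltD k a b : deg_lt k a -> deg_lt k b -> deg_lt k (a + b).
Proof.
move=> ha hb al; rewrite coefD; have [a0|nz _] := eqVneq (coef a al) 0; last exact: ha.
by rewrite a0 add0r; apply: hb.
Qed.

Lemma deg_lt_iotaM k r a : deg_lt k a -> deg_lt k (iota r * a).
Proof.
by move=> ha al; rewrite coef_iotaM => nz; apply: ha; apply: contraNneq nz => ->; rewrite mulr0.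
Qed.

Lemma deg_ltN k a : deg_lt k a -> deg_lt k (- a).
Proof. by move=> ha al; rewrite coefN oppr_eq0; apply: ha. Qed.

Lemma deg_lt_le k k' a : (k <= k')%N -> deg_lt k a -> deg_lt k' a.
Proof. by move=> kk' ha al /ha /leq_trans; apply. Qed.

Lemma deg_lt_mon r al : deg_lt (deg al).+1 (iota r * xm al).
Proof. by move=> be; rewrite coef_mon; case: (al =P be) => [<- _|_]; rewrite ?eqxx. Qed.

Lemma deg_lt_xmon al : deg_lt (deg al).+1 (xm al).
Proof. by rewrite -[xm al]mul1r -(rmorph1 iota); apply: deg_lt_mon. Qed.

Lemma deg_lt_sum k (I : eqType) (s : seq I) (F : I -> A) :
  (forall i, i \in s -> deg_lt k (F i)) -> deg_lt k (\sum_(i <- s) F i).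
Proof.
elim: s => [|i s IH] hF; first by rewrite big_nil; apply: deg_lt0.
rewrite big_cons; apply: deg_ltD; first by apply: hF; rewrite mem_head.
by apply: IH => j js; apply: hF; rewrite inE js orbT.
Qed.

Lemma coef_deg_lt k a al : deg_lt k a -> (k <= deg al)%N -> coef a al = 0.
Proof. by move=> ha; rewrite leqNgt; apply: contraNeq => /ha. Qed.

Lemma deg_lt_ind (P : A -> Prop) k a : deg_lt k a ->
  (forall b c, P b -> P c -> P (b + c)) -> P 0 ->
  (forall r al, (deg al < k)%N -> P (iota r * xm al)) -> P a.
Proof.
move=> ha PD P0 Pmon; rewrite (coef_expand a).
have : forall al, al \in supp a -> (deg al < k)%N by move=> al; rewrite mem_supp; apply: ha.
elim: (supp a) => [|al s IH] sk; first by rewrite big_nil.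
rewrite big_cons; apply: PD; first by apply: Pmon; apply: sk; rewrite mem_head.
by apply: IH => be bs; apply: sk; rewrite inE bs orbT.
Qed.

(* The flag
   [q] is instantiated with quasi-commutativity, so that the exact identities of
   the quasi-commutative case come out of the same computations. *)
Definition deg_ltq (q : bool) k a := deg_lt k a /\ (q -> a = 0).

Lemma deg_ltq0 q k : deg_ltq q k 0.
Proof. by split=> //; apply: deg_lt0. Qed.

Lemma deg_ltqD q k a b : deg_ltq q k a -> deg_ltq q k b -> deg_ltq q k (a + b).
Proof.
move=> [ha ha0] [hb hb0]; split; first exact: deg_ltD.
by move=> /[dup] /ha0 -> /hb0 ->; rewrite addr0.
Qed.

Lemma deg_ltq_iotaM q k r a : deg_ltq q k a -> deg_ltq q k (iota r * a).
Proof.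
by move=> [ha ha0]; split; [apply: deg_lt_iotaM | move=> /ha0 ->; rewrite mulr0].
Qed.

Lemma deg_ltq_le q k k' a : (k <= k')%N -> deg_ltq q k a -> deg_ltq q k' a.
Proof. by move=> kk' [ha ha0]; split=> //; apply: deg_lt_le ha. Qed.

Lemma deg_ltq_mon (q : bool) r al : (q -> r = 0) -> deg_ltq q (deg al).+1 (iota r * xm al).
Proof. by move=> r0; split; [apply: deg_lt_mon | move=> /r0 ->; rewrite rmorph0 mul0r]. Qed.

Local Notation sig := (sigmai iota x coef).
Local Notation sigE := (sigmaE iota x coef).
Local Notation cabx := (cab x coef).

Lemma sigmaE0 r : sigE (exp0 n) r = r.
Proof. exact: iter_exps0. Qed.

Lemma sigmaE_cons th j r : zero_below j th -> sigE (addE th (eunit j)) r = sig j (sigE th r).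
Proof. exact: iter_exps_cons. Qed.

Lemma sigmai_eq i r c r' : x i * iota r = iota c * x i + iota r' -> sig i r = c.
Proof.
move=> E; rewrite /sigmai E coefD -(xmon_eunit x i) coef_mon eqxx.
by rewrite -[iota r']mulr1 -(xmon0 x) coef_mon eq_sym (negbTE (eunit_neq0 i)) addr0.
Qed.

Lemma sigmai_neq0 i r : r != 0 -> sig i r != 0.
Proof.
move=> r_neq0; case: HPBW => _ _ _ comm _; have [c c_neq0 [r' E]] := comm i r r_neq0.
by rewrite (@sigmai_eq i r c r') // -E addrC subrK.
Qed.

Lemma sigmaE_neq0 th r : r != 0 -> sigE th r != 0.
Proof.
move=> r_neq0; elim/exps_ind: th => [|th j zth IH]; first by rewrite sigmaE0.
by rewrite sigmaE_cons //; apply: sigmai_neq0.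
Qed.

Lemma sigmaE_r0 th : sigE th 0 = 0.
Proof.
elim/exps_ind: th => [|th j zth IH]; first exact: sigmaE0.
by rewrite sigmaE_cons // IH /sigmai rmorph0 mulr0 coef0.
Qed.

Let noqc : false -> quasi_commutative iota x := fun f => False_ind _ (notF f).

Lemma x_iota (q : bool) (Hq : q -> quasi_commutative iota x) i r : exists r',
  x i * iota r = iota (sig i r) * x i + iota r' /\ (q -> r' = 0).
Proof.
have [c [r' [E r'0]]] : exists c r', x i * iota r = iota c * x i + iota r' /\ (q -> r' = 0).
  have [->|r_neq0] := eqVneq r 0.
    by exists 0, 0; rewrite !rmorph0 mulr0 mul0r addr0.
  case: q Hq => [/(_ isT) [qc _]|_].
    by have [c _ E] := qc i r r_neq0; exists c, 0; rewrite rmorph0 addr0.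
  case: HPBW => _ _ _ comm _; have [c _ [r' E]] := comm i r r_neq0.
  by exists c, r'; rewrite -E addrC subrK.
by exists r'; rewrite (sigmai_eq E).
Qed.

Lemma x_x (q : bool) (Hq : q -> quasi_commutative iota x) i j : exists c rem,
  x i * x j = iota c * x j * x i + rem /\ deg_ltq q 2 rem.
Proof.
case: q Hq => [/(_ isT) [_ qc]|_].
  by have [c _ E] := qc j i; exists c, 0; rewrite addr0; split=> //; apply: deg_ltq0.
case: HPBW => _ _ _ _ comm; have [c _ [r0 [r E]]] := comm j i.
exists c, (iota r0 + \sum_(k < n) iota (r k) * x k).
split; first by rewrite -E addrC subrK.
split=> //; apply: deg_ltD.
  by rewrite -[iota r0]mulr1 -(xmon0 x); apply: (deg_lt_le _ (@deg_lt_mon _ _)); rewrite deg_exp0.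
apply: deg_lt_sum => k _; rewrite -(xmon_eunit x k).
by apply: (deg_lt_le _ (@deg_lt_mon _ _)); rewrite deg_eunit.
Qed.

Lemma deg_lt_mulx_from k : (forall be i, (deg be < k)%N ->
    exists u, deg_lt (deg be).+1 (x i * xm be - iota u * xm (addE be (eunit i)))) ->
  forall a j, deg_lt k a -> deg_lt k.+1 (x j * a).
Proof.
move=> x_xm a j ha; apply: (deg_lt_ind (P := fun b => deg_lt k.+1 (x j * b)) ha).
- by move=> b c hb hc; rewrite mulrDr; apply: deg_ltD.
- by rewrite mulr0; apply: deg_lt0.
move=> r be dbe; have [r' [E _]] := x_iota noqc j r.
rewrite mulrA E mulrDl; apply: deg_ltD; last first.
  by apply: (deg_lt_le _ (@deg_lt_mon _ _)); rewrite ltnS ltnW.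
have [u hu] := x_xm be j dbe.
rewrite -mulrA -[x j * xm be](subrK (iota u * xm (addE be (eunit j)))) mulrDr.
apply: deg_ltD; first by apply/deg_lt_iotaM/(deg_lt_le _ hu); rewrite ltnS ltnW.
by rewrite mulrA -rmorphM; apply: (deg_lt_le _ (@deg_lt_mon _ _)); rewrite deg_addE_eunit.
Qed.

Lemma deg_lt2_mul_xmon_from d a al :
  (forall k b j, (k <= d)%N -> deg_lt k b -> deg_lt k.+1 (x j * b)) ->
  (deg al < d)%N -> deg_lt 2 a -> deg_lt (deg al).+2 (a * xm al).
Proof.
move=> mulx dal a_lt.
apply: (deg_lt_ind (P := fun b => deg_lt (deg al).+2 (b * xm al)) a_lt).
- by move=> b b' hb hb'; rewrite mulrDl; apply: deg_ltD.
- by rewrite mul0r; apply: deg_lt0.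
move=> r ga /deg_lt2 [->|[k ->]]; rewrite -mulrA; apply: deg_lt_iotaM.
  by rewrite xmon0 mul1r; apply: (deg_lt_le _ (@deg_lt_xmon _)).
by rewrite xmon_eunit; apply: mulx (@deg_lt_xmon _).
Qed.

Lemma x_xmon_bounded d (q : bool) (Hq : q -> quasi_commutative iota x) al i :
  (deg al < d)%N ->
  exists u, deg_ltq q (deg al).+1 (x i * xm al - iota u * xm (addE al (eunit i))).
Proof.
elim: d q Hq al i => [//|d IH] q Hq al i dal.
have mulx k a j : (k <= d)%N -> deg_lt k a -> deg_lt k.+1 (x j * a).
  move=> kd; apply: deg_lt_mulx_from => be i' dbe.
  by have [u [hu _]] := IH false noqc be i' (leq_trans dbe kd); exists u.
have [d0|dpos] := posnP (deg al).
  exists 1; rewrite (deg_eq0 d0) add0E xmon0 mulr1 rmorph1 mul1r xmon_eunit subrr.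
  exact: deg_ltq0.
have [j [al' [Eal zal' dal']]] := exps_split_least dpos.
have [ij|ji] := leqP i j.
  exists 1; rewrite rmorph1 mul1r xmon_cons ?subrr; first exact: deg_ltq0.
  move=> k ki; rewrite Eal !ffunE zal' ?(leq_trans ki ij) //.
  by case: eqP => // ekj; move: ki; rewrite ekj ltnNge ij.
(* For [j < i], write x_i x_j = c x_j x_i + rem and apply induction to x_i x^al'. *)
have dal'd : (deg al' < d)%N by rewrite -ltnS -dal'.
have [c [rem [Exx [rem_lt rem0]]]] := x_x Hq i j.
have [u' [hu' hu'0]] := IH q Hq al' i dal'd.
set be := addE al' (eunit i) in hu' hu'0.
have zbe : zero_below j be.
  move=> k kj; rewrite ffunE zal' //= ffunE; case: eqP => // eki.
  by move: kj; rewrite eki ltnNge ltnW.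
have [r'' [Exr r''0]] := x_iota Hq j u'.
have Ebe : addE be (eunit j) = addE al (eunit i).
  by rewrite Eal /be -!addEA [addE (eunit i) _]addEC.
exists (c * sig j u').
set rem' := x i * xm al' - iota u' * xm be in hu' hu'0.
have -> : x i * xm al = iota (c * sig j u') * xm (addE al (eunit i)) +
    (iota (c * r'') * xm be + iota c * (x j * rem') + rem * xm al').
  rewrite {1}Eal xmon_cons // mulrA Exx mulrDl -!mulrA.
  rewrite -[x i * xm al'](subrK (iota u' * xm be)) -/rem' mulrDr mulrA Exr.
  rewrite -Ebe xmon_cons // !rmorphM mulrDl mulrDr !mulrA.
  by rewrite -!addrA mulrDr !mulrA -!addrA addrCA; congr (_ + _); rewrite addrCA.
rewrite addrC addKr; apply: deg_ltqD; first apply: deg_ltqD.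
- apply: (deg_ltq_le _ (deg_ltq_mon _ _)); first by rewrite deg_addE_eunit dal'.
  by move=> /r''0 ->; rewrite mulr0.
- split; first by apply: deg_lt_iotaM; rewrite dal'; apply: mulx hu'.
  by move=> /hu'0 ->; rewrite !mulr0.
split; last by move=> /rem0 ->; rewrite mul0r.
by rewrite dal'; apply: deg_lt2_mul_xmon_from mulx dal'd rem_lt.
Qed.

Lemma x_xmon (q : bool) (Hq : q -> quasi_commutative iota x) al i :
  exists u, deg_ltq q (deg al).+1 (x i * xm al - iota u * xm (addE al (eunit i))).
Proof. exact: x_xmon_bounded (ltnSn _). Qed.

Lemma deg_lt_mulx k a i : deg_lt k a -> deg_lt k.+1 (x i * a).
Proof.
apply: deg_lt_mulx_from => be j _.
by have [u [hu _]] := x_xmon noqc be j; exists u.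
Qed.

Lemma deg_ltq_mulx q k a i : deg_ltq q k a -> deg_ltq q k.+1 (x i * a).
Proof. by move=> [ha ha0]; split; [apply: deg_lt_mulx | move=> /ha0 ->; rewrite mulr0]. Qed.

Lemma xmon_iota (q : bool) (Hq : q -> quasi_commutative iota x) th r :
  deg_ltq q (deg th) (xm th * iota r - iota (sigE th r) * xm th).
Proof.
elim/exps_ind: th r => [|th j zth IH] r.
  by rewrite xmon0 sigmaE0 mul1r mulr1 subrr; apply: deg_ltq0.
have [r'' [Exr r''0]] := x_iota Hq j (sigE th r).
have := IH r; set rem := _ - _ => hrem.
rewrite xmon_cons // sigmaE_cons // deg_addE_eunit -mulrA.
rewrite -[xm th * iota r](subrK (iota (sigE th r) * xm th)) -/rem mulrDr mulrA Exr.
rewrite mulrDl -mulrA addrCA mulrA addrAC subrr add0r.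
by apply: deg_ltqD; [apply: deg_ltq_mulx | apply: deg_ltq_mon].
Qed.

Lemma xmon_mul_exists (q : bool) (Hq : q -> quasi_commutative iota x) al be :
  exists u, deg_ltq q (deg al + deg be) (xm al * xm be - iota u * xm (addE al be)).
Proof.
elim/exps_ind: al => [|al j zal [u' hu']].
  by exists 1; rewrite xmon0 add0E mul1r rmorph1 mul1r subrr; apply: deg_ltq0.
set rem' := _ - _ in hu'.
have [r'' [Exr r''0]] := x_iota Hq j u'.
have [v hv] := x_xmon Hq (addE al be) j.
set rem'' := _ - _ in hv.
have Eab : addE (addE al be) (eunit j) = addE (addE al (eunit j)) be.
  by rewrite -!addEA [addE be _]addEC.
exists (sig j u' * v); rewrite Eab in rem'' hv.
rewrite xmon_cons // -mulrA -[xm al * xm be](subrK (iota u' * xm (addE al be))) -/rem'.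
rewrite mulrDr mulrA Exr mulrDl -mulrA.
rewrite -[x j * xm (addE al be)](subrK (iota v * xm (addE (addE al (eunit j)) be))) -/rem''.
set T := iota (sig j u' * v) * _.
have -> : x j * rem' + (iota (sig j u') * (rem'' + iota v * xm (addE (addE al (eunit j)) be)) +
    iota r'' * xm (addE al be)) - T =
  iota (sig j u') * rem'' + iota r'' * xm (addE al be) + x j * rem'.
  rewrite [iota (sig j u') * (_ + _)]mulrDr [iota (sig j u') * (iota v * _)]mulrA.
  rewrite -rmorphM -/T.
  by rewrite [_ + T + _]addrAC addrA addrK addrC.
rewrite deg_addE_eunit addSn; apply: deg_ltqD; first apply: deg_ltqD.
- by apply: deg_ltq_iotaM; rewrite -degD.
- by rewrite -degD; apply: deg_ltq_mon.
- exact: deg_ltq_mulx.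
Qed.

Lemma xmon_mul (q : bool) (Hq : q -> quasi_commutative iota x) al be :
  deg_ltq q (deg al + deg be) (xm al * xm be - iota (cabx al be) * xm (addE al be)).
Proof.
have [u hu] := xmon_mul_exists Hq al be.
suff -> : cabx al be = u by [].
rewrite /cab -[xm al * xm be](subrK (iota u * xm (addE al be))) coefD coef_mon eqxx.
by rewrite (coef_deg_lt hu.1) ?degD // add0r.
Qed.

Lemma deg_ltM k l a b : deg_lt k a -> deg_lt l.+1 b -> deg_lt (k + l) (a * b).
Proof.
have [K] := ubnP k; elim: K k l a b => [//|K IH] k l a b kK ha hb.
apply: (deg_lt_ind (P := fun a => deg_lt (k + l) (a * b)) ha).
- by move=> c c' hc hc'; rewrite mulrDl; apply: deg_ltD.
- by rewrite mul0r; apply: deg_lt0.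
move=> r al dal; rewrite -mulrA; apply: deg_lt_iotaM.
apply: (deg_lt_ind (P := fun b => deg_lt (k + l) (xm al * b)) hb).
- by move=> c c' hc hc'; rewrite mulrDr; apply: deg_ltD.
- by rewrite mulr0; apply: deg_lt0.
move=> r' be dbe; rewrite mulrA.
have [S_lt _] := xmon_iota noqc al r'.
rewrite -[xm al * iota r'](subrK (iota (sigE al r') * xm al)) mulrDl.
apply: deg_ltD.
  have dalK : (deg al < K)%N := leq_trans dal kK.
  apply: (deg_lt_le _ (IH _ _ _ _ dalK S_lt (@deg_lt_xmon be))).
  by rewrite leq_add // ltnW.
have [X_lt _] := xmon_mul noqc al be.
rewrite -mulrA -[xm al * xm be](subrK (iota (cabx al be) * xm (addE al be))) mulrDr.
apply: deg_ltD; first by apply/deg_lt_iotaM/(deg_lt_le _ X_lt); rewrite leq_add // ltnW.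
rewrite mulrA -rmorphM; apply: (deg_lt_le _ (@deg_lt_mon _ _)).
by rewrite degD -addSn leq_add.
Qed.

Lemma xmon_mon (q : bool) (Hq : q -> quasi_commutative iota x) th r al :
  deg_ltq q (deg th + deg al)
    (xm th * (iota r * xm al) - iota (sigE th r * cabx th al) * xm (addE th al)).
Proof.
have [S_lt S0] := xmon_iota Hq th r.
have X_ltq := xmon_mul Hq th al.
set S := xm th * iota r - _ in S_lt S0; set X := xm th * xm al - _ in X_ltq.
have -> : xm th * (iota r * xm al) - iota (sigE th r * cabx th al) * xm (addE th al) =
    iota (sigE th r) * X + S * xm al.
  by rewrite /S /X mulrBr mulrBl !mulrA -rmorphM [RHS]addrC addrA subrK.
apply: deg_ltqD; first exact: deg_ltq_iotaM.
by split; [apply: deg_ltM S_lt (@deg_lt_xmon al) | move=> /S0 ->; rewrite mul0r].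
Qed.

Lemma xmon_mul_top D a th : deg_lt D.+1 a ->
  [/\ deg_lt (deg th + D).+1 (xm th * a),
      forall ze, deg ze = D ->
        coef (xm th * a) (addE th ze) = sigE th (coef a ze) * cabx th ze
    & forall de, deg de = (deg th + D)%N -> coef (xm th * a) de != 0 ->
        exists2 ze, de = addE th ze & coef a ze != 0].
Proof.
move=> ha.
set G := \sum_(al <- supp a) iota (sigE th (coef a al) * cabx th al) * xm (addE th al).
have G_top de : deg de = (deg th + D)%N -> coef (xm th * a) de = coef G de.
  have lower : deg_lt (deg th + D) (xm th * a - G).
    rewrite {1}(coef_expand a) mulr_sumr /G -sumrB; apply: deg_lt_sum => al als.
    have [mon_lt _] := xmon_mon noqc th (coef a al) al.
    apply: deg_lt_le mon_lt; rewrite leq_add2l -ltnS; apply: ha.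
    by rewrite -mem_supp.
  by move=> dde; rewrite -[xm th * a](subrK G) coefD (coef_deg_lt lower) ?dde ?add0r.
have coefG de : coef G de =
    \sum_(al <- supp a) (if addE th al == de then sigE th (coef a al) * cabx th al else 0).
  by rewrite /G coef_sum; apply: eq_bigr => al _; rewrite coef_mon.
split.
- by have := deg_ltM (@deg_lt_xmon th) ha; rewrite addSn.
- move=> ze dze; rewrite G_top ?degD ?dze // coefG.
  under eq_bigr => al _ do rewrite (inj_eq (@addEI _ th)).
  have [zs|] := boolP (ze \in supp a).
    by rewrite (bigD1_seq ze) ?supp_uniq //= eqxx big1 ?addr0 // => al /negbTE ->.
  rewrite mem_supp negbK => /eqP za0; rewrite za0 sigmaE_r0 mul0r big1_seq // => al.
  by rewrite mem_supp; case: (al =P ze) => // ->; rewrite za0 eqxx.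
- move=> de dde; rewrite G_top // coefG => /sum_neq0 [al als].
  case: (addE th al =P de) => [<- _|_]; last by rewrite eqxx.
  by exists al; rewrite // -mem_supp.
Qed.

Variables (ordA : rel (exps n)) (m : nat) (ordM : rel (exps n * 'I_m)).
Hypothesis HordA : monomial_order_A x supp ordA.
Hypothesis HordM : monomial_order_Am x supp ordA ordM.
Hypothesis Hcab : forall a b : exps n, two_sided_unit (cab x coef a b).

Local Notation vec := 'cV[A]_m.
Local Notation lmM := (lm supp ordM).
Local Notation vc := (vcoef coef).
(* [ordM X Y] reads X >= Y, so [gtM X Y] is X > Y. *)
Local Notation gtM := (strict ordM).
Implicit Types (f h p : vec) (X Y : exps n * 'I_m).

Let totA : total_order ordA. Proof. by case: HordA. Qed.
Let totM : total_order ordM. Proof. by case: HordM. Qed.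

Lemma deg_gtM X Y : (deg Y.1 < deg X.1)%N -> gtM X Y.
Proof. by case: HordM => _ _ _; apply. Qed.

Lemma vcoef0 X : vc (0 : vec) X = 0.
Proof. by rewrite /vcoef mxE coef0. Qed.

Lemma vcoefD f (g : vec) X : vc (f + g) X = vc f X + vc g X.
Proof. by rewrite /vcoef mxE coefD. Qed.

Lemma vcoefB f (g : vec) X : vc (f - g) X = vc f X - vc g X.
Proof. by rewrite /vcoef !mxE coefB. Qed.

Lemma vcoef_sum (I : Type) (s : seq I) (G : I -> vec) X :
  vc (\sum_(i <- s) G i) X = \sum_(i <- s) vc (G i) X.
Proof.
elim: s => [|i s IH]; first by rewrite !big_nil vcoef0.
by rewrite !big_cons vcoefD IH.
Qed.

Lemma vcoef_iotaZ r f X : vc (iota r *: f) X = r * vc f X.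
Proof. by rewrite /vcoef mxE coef_iotaM. Qed.

Lemma vcoef_eq0 f : (forall X, vc f X = 0) -> f = 0.
Proof.
move=> f0; apply/matrixP => i j; rewrite (ord1 j) mxE; apply: coef_eq0 => al.
exact: (f0 (al, i)).
Qed.

Lemma mem_vsupp f X : (X \in vsupp supp f) = (vc f X != 0).
Proof.
case: X => al i; rewrite /vcoef /= -mem_supp.
apply/allpairsPdep/idP => [[j [be [_ hb [-> ->]]]] //|h].
by exists i, al; rewrite mem_enum.
Qed.

Lemma lmP f X : lmM f = Some X <-> vc f X != 0 /\ (forall Y, vc f Y != 0 -> ordM X Y).
Proof.
split=> [/(omax_some totM) [Xs Xmax]|[fX Xmax]].
  by split=> [|Y]; rewrite -mem_vsupp //; apply: Xmax.
by apply: (omax_eq totM) => [|Y]; rewrite mem_vsupp //; apply: Xmax.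
Qed.

Lemma lm_eq0 f : lmM f = None -> f = 0.
Proof.
move=> /omax_none f0; apply: vcoef_eq0 => X; apply/eqP; apply: contraT.
by rewrite -mem_vsupp f0.
Qed.

Lemma lm0 : lmM (0 : vec) = None.
Proof.
by case E: (lmM 0) => [X|] //; have [] := proj1 (lmP 0 X) E; rewrite vcoef0 eqxx.
Qed.

Lemma lm_neq0 f : f != 0 -> exists X, lmM f = Some X.
Proof. by case E: (lmM f) => [X|]; [exists X | rewrite (lm_eq0 E) eqxx]. Qed.

Definition below f X := forall Y, vc f Y != 0 -> ordM X Y.
Definition sbelow f X := forall Y, vc f Y != 0 -> gtM X Y.

Lemma lm_below f X : lmM f = Some X -> below f X.
Proof. by move=> /lmP[]. Qed.

Lemma sbelowW f X : sbelow f X -> below f X.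
Proof. by move=> fX Y /fX /strictW. Qed.

Lemma sbelow_vcoef f X : sbelow f X -> vc f X = 0.
Proof. by move=> fX; apply/eqP; apply: contraT => /fX; rewrite strict_irr. Qed.

Lemma gtO_lm_sbelow X p : gtO ordM (Some X) (lmM p) <-> sbelow p X.
Proof.
case E: (lmM p) => [Y|] /=; last by split=> // _ Z; rewrite (lm_eq0 E) vcoef0 eqxx.
have [pY Ymax] := proj1 (lmP p Y) E.
by split=> [XY Z /Ymax|]; [apply: strict_le_trans XY | apply].
Qed.

Lemma sbelow_deg_lt f g k : (forall j, deg_lt (deg g) (f j 0)) -> sbelow f (g, k).
Proof.
by move=> f_lt [de j]; rewrite /vcoef /= => /f_lt; apply: (@deg_gtM (g, k) (de, j)).
Qed.

Lemma below_sum (I : eqType) (s : seq I) (G : I -> vec) X :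
  (forall i, i \in s -> below (G i) X) -> below (\sum_(i <- s) G i) X.
Proof.
move=> GX Y; rewrite vcoef_sum => /sum_neq0 [i si GiY].
exact: GX si _ GiY.
Qed.

Lemma sbelow_sum (I : eqType) (s : seq I) (G : I -> vec) X :
  (forall i, i \in s -> sbelow (G i) X) -> sbelow (\sum_(i <- s) G i) X.
Proof.
move=> GX Y; rewrite vcoef_sum => /sum_neq0 [i si GiY].
exact: GX si _ GiY.
Qed.

Lemma sbelowD p1 p2 X : sbelow p1 X -> sbelow p2 X -> sbelow (p1 + p2) X.
Proof.
move=> p1X p2X Y; rewrite vcoefD.
have [p10|nz _] := eqVneq (vc p1 Y) 0; last exact: p1X.
by rewrite p10 add0r; apply: p2X.
Qed.

Lemma mul_cab_neq0 r al be : r != 0 -> r * cabx al be != 0.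
Proof.
have [u [_ cu]] := Hcab al be; apply: contraNneq => rc0.
by rewrite -[r]mulr1 -cu mulrA rc0 mul0r.
Qed.

Lemma lmA_xmonM th al : lmA supp ordA (xm th * xm al) = Some (addE th al).
Proof.
apply: (omax_eq totA) => [|be].
  by rewrite mem_supp; have := @mul_cab_neq0 1 th al (oner_neq0 R); rewrite mul1r.
rewrite mem_supp => be_neq0; have [<-|ne] := eqVneq (addE th al) be; first by case: totA.
have [X_lt _] := xmon_mul noqc th al.
case: HordA => _ _ _ deg_ord; apply: (proj1 (andP (deg_ord _ _ _))).
rewrite degD; apply: X_lt.
by rewrite coefB coef_mon (negbTE ne) subr0.
Qed.

Lemma ordM_addE th al j be i :
  ordM (al, j) (be, i) -> ordM (addE th al, j) (addE th be, i).
Proof. by case: HordM => _ _ compat _ /(compat _ _ _ _ th); rewrite !lmA_xmonM. Qed.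

Lemma below_deg_lt f g k : below f (g, k) -> forall j, deg_lt (deg g).+1 (f j 0).
Proof.
move=> fgk j ze fze; rewrite ltnS leqNgt; apply/negP => /(@deg_gtM (ze, j) (g, k)).
by move/(strict_leF totM); rewrite fgk.
Qed.

Lemma below_xmonZ th f g k : below f (g, k) ->
  [/\ below (xm th *: f) (addE th g, k),
      sbelow f (g, k) -> sbelow (xm th *: f) (addE th g, k)
    & vc (xm th *: f) (addE th g, k) = sigE th (vc f (g, k)) * cabx th g].
Proof.
move=> fgk.
have top de j : vc (xm th *: f) (de, j) != 0 ->
    gtM (addE th g, k) (de, j) \/ exists2 ze, de = addE th ze & vc f (ze, j) != 0.
  rewrite /vcoef /= mxE => nz.
  have [lt _ top] := xmon_mul_top th (below_deg_lt (j := j) fgk).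
  have := lt _ nz; rewrite ltnS leq_eqVlt => /orP[/eqP dde|dlt]; first by right; apply: top.
  by left; apply: deg_gtM; rewrite /= degD.
split.
- move=> [de j] /top [/strictW //|[ze -> fze]].
  exact/ordM_addE/fgk.
- move=> fgk' [de j] /top [//|[ze -> /fgk' /andP[le ne]]].
  by rewrite /strict ordM_addE //=; apply: contra ne => /eqP [/addEI -> ->].
- rewrite /vcoef /= mxE.
  by have [_ coef_top _] := xmon_mul_top th (below_deg_lt (j := k) fgk); apply: coef_top.
Qed.

Lemma lm_xmonZ th f g k : lmM f = Some (g, k) -> lmM (xm th *: f) = Some (addE th g, k).
Proof.
move=> E; have [lt_th _ top] := below_xmonZ th (lm_below E).
apply/lmP; split=> //; rewrite top; apply: mul_cab_neq0; apply: sigmaE_neq0.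
by case: (proj1 (lmP _ _) E).
Qed.

Lemma lmD_sbelow f p X : lmM f = Some X -> sbelow p X ->
  lmM (f + p) = Some X /\ vc (f + p) X = vc f X.
Proof.
move=> /lmP [fX Xmax] pX.
have fpX : vc (f + p) X = vc f X by rewrite vcoefD (sbelow_vcoef pX) addr0.
split=> //; apply/lmP; split=> [|Y]; first by rewrite fpX.
rewrite vcoefD; have [fY0|fY _] := eqVneq (vc f Y) 0; last exact: Xmax.
by rewrite fY0 add0r => /pX /strictW.
Qed.

Local Notation lcM := (lc coef supp ordM).

Lemma lc_lm f X : lmM f = Some X -> lcM f = vc f X.
Proof. by rewrite /lc => ->. Qed.

Lemma below_red_term r al fi (b : exps n) k : lmM fi = Some (b, k) ->
  below ((iota r * xm al) *: fi) (addE al b, k) /\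
  vc ((iota r * xm al) *: fi) (addE al b, k) = r * sigE al (lcM fi) * cabx al b.
Proof.
move=> E; have [below_al _ top] := below_xmonZ al (lm_below E).
rewrite -scalerA (lc_lm E); split; last by rewrite vcoef_iotaZ top mulrA.
move=> Y; rewrite vcoef_iotaZ => nz; apply: below_al.
by apply: contraNneq nz => ->; rewrite mulr0.
Qed.

Variable F : seq vec.
Local Notation red := (red1 iota x coef supp ordM F).
Local Notation redp := (redplus iota x coef supp ordM F).

Lemma red1_from0 f h : red f h -> f = 0 -> h = 0.
Proof.
case=> [[_ ->] //|[[|e s] [hs _ ->]] f0]; first by rewrite big_nil f0 subr0.
by have [_ [b [i [_]]]] := hs e (mem_head _ _); rewrite f0 lm0.
Qed.

Lemma red1_sbelow f h X : red f h -> lmM f = Some X -> sbelow h X.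
Proof.
case=> [[f0 _]|[s [hs lc_f ->]]] E; first by rewrite f0 lm0 in E.
case: X E => g k E.
set D := \sum_(e <- s) _.
have term e : e \in s -> below ((iota e.2 * xm e.1.2) *: e.1.1) (g, k) /\
    vc ((iota e.2 * xm e.1.2) *: e.1.1) (g, k) =
    e.2 * sigE e.1.2 (lcM e.1.1) * (if lmM e.1.1 is Some Y then cabx e.1.2 Y.1 else 0).
  move=> es; have [_ [b [i [E1]]]] := hs e es.
  by rewrite E E1 => -[-> ->]; apply: below_red_term.
have D_below : below D (g, k) by apply: below_sum => e /term [].
have D_top : vc D (g, k) = lcM f.
  by rewrite vcoef_sum lc_f; apply: eq_big_seq => e /term [].
have [_ gk_max] := proj1 (lmP f (g, k)) E.
move=> Y; rewrite vcoefB => hY.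
have gk_Y : ordM (g, k) Y.
  have [fY0|] := eqVneq (vc f Y) 0; last exact: gk_max.
  by apply: D_below; move: hY; rewrite fY0 sub0r oppr_eq0.
rewrite /strict gk_Y /=; apply: contra hY => /eqP <-.
by rewrite D_top (lc_lm E) subrr.
Qed.

Lemma red1_addr f h p X : red f h -> lmM f = Some X -> sbelow p X -> red (f + p) (h + p).
Proof.
case=> [[f0 _]|[s [hs lc_f Eh]]] E pX; first by rewrite f0 lm0 in E.
have [lm_fp lc_fp] := lmD_sbelow E pX.
right; exists s; split.
- move=> e es; have [Fe [b [i [E1 E2]]]] := hs e es; split=> //.
  by exists b, i; rewrite lm_fp -E.
- by rewrite (lc_lm lm_fp) lc_fp -(lc_lm E).
- by rewrite Eh addrAC.
Qed.

Lemma redplus_from0 f h : redp f h -> f = 0 -> h = 0.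
Proof. by elim=> [f' h' /red1_from0 //|f' g' h' /red1_from0 r _ IH] /r /IH. Qed.

Lemma redplus_sbelow f h X : redp f h -> lmM f = Some X -> sbelow h X.
Proof.
move=> r; elim: r X => [f' h' /red1_sbelow //|f' g' h' r r' IH] X E.
have [g0|g_neq0] := eqVneq g' 0.
  by rewrite (redplus_from0 r' g0) => Y; rewrite vcoef0 eqxx.
have [Y EY] := lm_neq0 g_neq0.
have XY : gtM X Y by apply: (red1_sbelow r E); case: (proj1 (lmP _ _) EY).
by move=> Z /(IH _ EY) /(le_strict_trans totM (strictW XY)).
Qed.

Lemma redplus_addr f h p : redp f h -> p = 0 \/ gtO ordM (lmM h) (lmM p) ->
  redp (f + p) (h + p).
Proof.
move=> r [->|]; first by rewrite !addr0.
case Eh: (lmM h) => [Xh|//] /gtO_lm_sbelow pXh.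
have lm_above f' : redp f' h -> exists2 Xf, lmM f' = Some Xf & sbelow p Xf.
  move=> r'; have [f'0|f'_neq0] := eqVneq f' 0.
    by move: Eh; rewrite (redplus_from0 r' f'0) lm0.
  have [Xf Ef] := lm_neq0 f'_neq0; exists Xf => //.
  have XfXh : gtM Xf Xh by apply: (redplus_sbelow r' Ef); case: (proj1 (lmP _ _) Eh).
  by move=> Y /pXh; exact: (le_strict_trans totM (strictW XfXh)).
elim: r lm_above => [f' h' r|f' g' h' r r' IH] lm_above.
  have [Xf Ef pXf] := lm_above _ (redplus_one r).
  by apply/redplus_one/(red1_addr r Ef pXf).
have [Xf Ef pXf] := lm_above _ (redplus_step r r').
by apply: redplus_step (red1_addr r Ef pXf) (IH _).
Qed.

Lemma red1_xmonZ_sbelow (q : bool) (Hq : q -> quasi_commutative iota x) th f h g k :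
  red f h -> lmM f = Some (g, k) ->
  exists p, [/\ sbelow p (addE th g, k), (q -> p = 0) & red (xm th *: f + p) (xm th *: h)].
Proof.
move=> rfh E; have h_lt := red1_sbelow rfh E.
case: rfh => [[f0 _]|[s [hs lc_f Eh]]]; first by rewrite f0 lm0 in E.
have lm_term e : e \in s -> exists2 b, lmM e.1.1 = Some (b, k) & addE e.1.2 b = g.
  by move=> es; have [_ [b [i [E1]]]] := hs e es; rewrite E => -[-> ->]; exists b.
pose r' (e : vec * exps n * R) := sigE th e.2 * cabx th e.1.2.
(* [c e] is minus the part of x^th r x^al of degree below |th + al|. *)
pose c e := iota (r' e) * xm (addE th e.1.2) - xm th * (iota e.2 * xm e.1.2).
pose p := \sum_(e <- s) c e *: e.1.1.
have p_lt : sbelow p (addE th g, k).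
  apply: sbelow_sum => e es; apply: sbelow_deg_lt => j; rewrite mxE.
  have [b Eb <-] := lm_term e es; have [c_lt _] := xmon_mon noqc th e.2 e.1.2.
  rewrite !degD addnA; apply: deg_ltM (below_deg_lt (j := j) (lm_below Eb)).
  by rewrite /c -opprB; apply: deg_ltN.
have [lm_fp lc_fp] := lmD_sbelow (lm_xmonZ th E) p_lt.
have Exh : xm th *: h = xm th *: f + p - \sum_(e <- s) (iota (r' e) * xm (addE th e.1.2)) *: e.1.1.
  rewrite Eh scalerBr scaler_sumr -addrA; congr (_ + _).
  rewrite /p -sumrB -sumrN; apply: eq_bigr => e _.
  by rewrite /c scalerBl addrAC subrr add0r scalerA.
exists p; split=> //.
  move=> qt; rewrite /p big1_seq // => e _.
  have [_ c0] := xmon_mon Hq th e.2 e.1.2.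
  by rewrite /c -opprB (c0 qt) oppr0 scale0r.
right; exists [seq (e.1.1, addE th e.1.2, r' e) | e <- s]; split.
- move=> _ /mapP [e es ->] /=; have [Fe _] := hs e es; split=> //.
  have [b Eb Eg] := lm_term e es; exists b, k.
  by rewrite lm_fp -Eg addEA.
- rewrite big_map (lc_lm lm_fp) lc_fp.
  have xh0 : vc (xm th *: h) (addE th g, k) = 0.
    have [_ sbelow_xh _] := below_xmonZ th (sbelowW h_lt).
    exact/sbelow_vcoef/sbelow_xh.
  move: xh0; rewrite Exh vcoefB vcoefD (sbelow_vcoef p_lt) addr0.
  move=> /eqP; rewrite subr_eq0 => /eqP ->; rewrite vcoef_sum.
  apply: eq_big_seq => e es /=; have [b Eb Eg] := lm_term e es.
  have [_ top] := below_red_term (r' e) (addE th e.1.2) Eb.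
  by rewrite Eb -Eg addEA top.
- by rewrite big_map.
Qed.

Lemma redplus_xmonZ_sbelow (q : bool) (Hq : q -> quasi_commutative iota x) th f h g k :
  redp f h -> lmM f = Some (g, k) ->
  exists p, [/\ sbelow p (addE th g, k), (q -> p = 0) & redp (xm th *: f + p) (xm th *: h)].
Proof.
move=> r; elim: r g k => [f' h' r|f' g' h' r r' IH] g k E.
  have [p [p_lt p0 rp]] := red1_xmonZ_sbelow Hq th r E.
  by exists p; split=> //; apply: redplus_one.
have [p1 [p1_lt p10 r1]] := red1_xmonZ_sbelow Hq th r E.
have [g'0|g'_neq0] := eqVneq g' 0.
  exists p1; split=> //; apply: redplus_step r1 _.
  by rewrite g'0 (redplus_from0 r' g'0) scaler0; apply: redplus_one; left.
have [[g2 k2] E2] := lm_neq0 g'_neq0.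
have [p2 [p2_lt p20 r2]] := IH _ _ E2.
have g'_lt := red1_sbelow r E.
have [_ xg'_lt _] := below_xmonZ th (sbelowW g'_lt).
have lt2 : gtM (addE th g, k) (addE th g2, k2).
  by apply: (xg'_lt g'_lt); case: (proj1 (lmP _ _) (lm_xmonZ th E2)).
have p2_lt' : sbelow p2 (addE th g, k).
  by move=> Y /p2_lt; exact: (le_strict_trans totM (strictW lt2)).
have [lm_fp _] := lmD_sbelow (lm_xmonZ th E) p1_lt.
exists (p1 + p2); split; first exact: sbelowD.
  by move=> qt; rewrite p10 // p20 // addr0.
by rewrite addrA; apply: redplus_step (red1_addr r1 lm_fp p2_lt') r2.
Qed.

Lemma redplus_xmonZ (q : bool) (Hq : q -> quasi_commutative iota x) th f h :
  redp f h -> exists p, [/\ p = 0 \/ gtO ordM (lmM (xm th *: f)) (lmM p), (q -> p = 0)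
                          & redp (xm th *: f + p) (xm th *: h)].
Proof.
move=> r; have [f0|f_neq0] := eqVneq f 0.
  exists 0; split; [by left | by [] |].
  by rewrite f0 (redplus_from0 r f0) scaler0 addr0; apply: redplus_one; left.
have [[g k] E] := lm_neq0 f_neq0.
have [p [p_lt p0 rp]] := redplus_xmonZ_sbelow Hq th r E.
by exists p; split=> //; right; rewrite (lm_xmonZ th E); apply/gtO_lm_sbelow.
Qed.

Lemma red1_xmonZ (q : bool) (Hq : q -> quasi_commutative iota x) th f h :
  red f h -> exists p, [/\ p = 0 \/ gtO ordM (lmM (xm th *: f)) (lmM p), (q -> p = 0)
                         & red (xm th *: f + p) (xm th *: h)].
Proof.
move=> r; have [f0|f_neq0] := eqVneq f 0.
  by exists 0; split; [left | | rewrite f0 (red1_from0 r f0) scaler0 addr0; left].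
have [[g k] E] := lm_neq0 f_neq0.
have [p [p_lt p0 rp]] := red1_xmonZ_sbelow Hq th r E.
by exists p; split=> //; right; rewrite (lm_xmonZ th E); apply/gtO_lm_sbelow.
Qed.

End PBWExtension.

Theorem proposition22
  (R A : nzRingType) (iota : {rmorphism R -> A}) (n : nat) (x : 'I_n -> A)
  (coef : A -> exps n -> R) (supp : A -> seq (exps n))
  (ordA : rel (exps n)) (m : nat) (ordM : rel (exps n * 'I_m))
  (HPBW : sigma_PBW iota x coef supp)
  (HnoethR : left_noetherian R)
  (HordA : monomial_order_A x supp ordA)
  (HordM : monomial_order_Am x supp ordA ordM)
  (Hcab : forall a b : exps n, two_sided_unit (cab x coef a b))
  (F : seq 'cV[A]_m) (HF : forall g, g \in F -> g != 0)
  (f h : 'cV[A]_m) (theta : exps n) :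
  let xt := xmon x theta in
  let red := red1 iota x coef supp ordM F in
  let redp := redplus iota x coef supp ordM F in
  let lmM := lm supp ordM in
  (* (i) *)
  (red f h ->
     exists2 p : 'cV[A]_m, p = 0 \/ gtO ordM (lmM (xt *: f)) (lmM p)
                         & red (xt *: f + p) (xt *: h))
  /\ (quasi_commutative iota x -> red f h -> red (xt *: f) (xt *: h))
  (* (ii) *)
  /\ (redp f h -> forall p : 'cV[A]_m, p = 0 \/ gtO ordM (lmM h) (lmM p) ->
        redp (f + p) (h + p))
  (* (iii) *)
  /\ (redp f h ->
     exists2 p : 'cV[A]_m, p = 0 \/ gtO ordM (lmM (xt *: f)) (lmM p)
                         & redp (xt *: f + p) (xt *: h))
  /\ (quasi_commutative iota x -> redp f h -> redp (xt *: f) (xt *: h))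
  (* (iv) *)
  /\ (redp f 0 ->
     exists2 p : 'cV[A]_m, p = 0 \/ gtO ordM (lmM (xt *: f)) (lmM p)
                         & redp (xt *: f + p) 0)
  /\ (quasi_commutative iota x -> redp f 0 -> redp (xt *: f) 0).
Proof.
move=> xt red redp lmM.
have noqc : false -> quasi_commutative iota x by [].
have red_xt := red1_xmonZ HPBW HordA HordM Hcab.
have redp_xt := redplus_xmonZ HPBW HordA HordM Hcab.
split; first by move=> /(red_xt _ _ noqc theta) [p [p_lt _ r]]; exists p.
split.
  by move=> qc /(red_xt _ true (fun=> qc) theta) [p [_ /(_ isT) -> r]]; rewrite addr0 in r.
split; first by move=> r p; apply: (redplus_addr HPBW HordA HordM Hcab r).
split; first by move=> /(redp_xt _ _ noqc theta) [p [p_lt _ r]]; exists p.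
split.
  by move=> qc /(redp_xt _ true (fun=> qc) theta) [p [_ /(_ isT) -> r]]; rewrite addr0 in r.
split.
  by move=> /(redp_xt _ _ noqc theta) [p [p_lt _ r]]; exists p; rewrite // -(scaler0 _ xt).
move=> qc /(redp_xt _ true (fun=> qc) theta) [p [_ /(_ isT) -> r]].
by rewrite addr0 scaler0 in r.
Qed.
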